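(* Let $\mathcal{B}$ be any infinite atomic Boolean algebra (i.e. infinite, and every nonzero element has an atom below it), regarded as a structure in the language $\{0,1,\cap,\cup,\neg\}\cup\{C_n:n\geq 1\}$, where $C_n(x)$ holds iff at least $n$ distinct atoms lie below $x$. Then there is no formula $\varphi(x)$ of this language whose interpretation in $\mathcal{B}$ is a set $Fin$ satisfying: $Fin$ is a proper ideal of $\mathcal{B}$; every $x$ with at most $n$ atoms below it lies in $Fin$ (for each $n<\omega$); and for every $x\notin Fin$ there is $y<x$ with $y\notin Fin$ and $x-y\notin Fin$.
   Context: $x<y$ means $x\leq y$ and $x\ne y$; $x-y=x\cap\neg y$. The formula $\varphi(x)$ has $x$ as its only free variable (no parameters). *)

(* Defs.v *)
From HB Require Import structures.
From mathcomp Require Import all_boot all_order.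
From mathcomp Require Import boolp classical_sets functions cardinality.

Set Implicit Arguments.
Unset Strict Implicit.
Unset Printing Implicit Defensive.

Import Order.Theory.

Local Open Scope classical_set_scope.
Local Open Scope card_scope.
Local Open Scope order_scope.

(* Boolean algebras are the [ctbDistrLatticeType]s (complemented distributive
   lattices with bottom and top).
   Terms and formulas are well-scoped de Bruijn syntax: the free variables of
   a term or formula indexed by [n] are among the [n] variables in ['I_n]; in
   particular [formula 1] is the type of parameter-free formulas phi(x). *)
Inductive term (n : nat) : Type :=
| Var of 'I_n
| Zero
| One
| Cap of term n & term n
| Cup of term n & term n
| Neg of term n.

(* The predicate symbols C_k exist for k >= 1 only. The variable bound by
   [All] and [Ex] is [ord0] in the body, the others being shifted by one. *)
Inductive formula : nat -> Type :=
| Eq n of term n & term n : formula n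
| Card n (k : nat) of (0 < k)%N & term n : formula n
| Not n of formula n : formula n
| And n of formula n & formula n : formula n
| Or n of formula n & formula n : formula n
| Imp n of formula n & formula n : formula n
| All n of formula n.+1 : formula n
| Ex n of formula n.+1 : formula n.

Definition extend_env (T : Type) n (b : T) (e : 'I_n -> T) : 'I_n.+1 -> T :=
  fun i => if unlift ord0 i is Some j then e j else b.

Definition is_atom d (B : ctbDistrLatticeType d) (a : B) : Prop :=
  a != \bot /\ forall b : B, b <= a -> b = \bot \/ b = a.

Definition atomic d (B : ctbDistrLatticeType d) : Prop :=
  forall x : B, x != \bot -> exists2 a : B, is_atom a & a <= x.

Definition atoms_below d (B : ctbDistrLatticeType d) (x : B) : set B :=
  [set a | is_atom a /\ a <= x].

Fixpoint eval d (B : ctbDistrLatticeType d) n (e : 'I_n -> B) (t : term n)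
  : B :=
  match t with
  | Var i => e i
  | Zero => \bot
  | One => \top
  | Cap t1 t2 => eval e t1 `&` eval e t2
  | Cup t1 t2 => eval e t1 `|` eval e t2
  | Neg t1 => ~` eval e t1
  end.

Fixpoint sat d (B : ctbDistrLatticeType d) n (f : formula n)
  : ('I_n -> B) -> Prop :=
  match f in formula m return ('I_m -> B) -> Prop with
  | Eq _ t1 t2 => fun e => eval e t1 = eval e t2
  | Card _ k _ t => fun e => `I_k #<= atoms_below (eval e t)
  | Not _ f1 => fun e => ~ sat f1 e
  | And _ f1 f2 => fun e => sat f1 e /\ sat f2 e
  | Or _ f1 f2 => fun e => sat f1 e \/ sat f2 e
  | Imp _ f1 f2 => fun e => sat f1 e -> sat f2 e
  | All _ f1 => fun e => forall b : B, sat f1 (extend_env b e)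
  | Ex _ f1 => fun e => exists b : B, sat f1 (extend_env b e)
  end.

Definition interp d (B : ctbDistrLatticeType d) (phi : formula 1) : set B :=
  [set x | sat phi (fun=> x)].
Arguments interp {d} B phi.

Definition proper_ideal d (B : ctbDistrLatticeType d) (I : set B) : Prop :=
  [/\ I \bot,
      forall x y, I x -> I y -> I (x `|` y),
      forall x y, I y -> x <= y -> I x
    & I <> [set: B]].

(* Main.v *)
(** An Ehrenfeucht-Fraisse argument. Sort the atoms by the variables of an
    environment that they lie below, and call two environments [N]-similar when
    all classes have the same size truncated at [N]. Every move from
    [2M]-similar environments can be answered so as to stay [M]-similar, so a
    formula [phi] cannot separate [N]-similar environments for a suitable [N].
    Splitting [\top] gives [y] with [y] and [~` y] both outside [Fin], so both
    have at least [N] atoms. The join [z] of [N] atoms of [y] lies in [Fin],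
    while [z] and [~` z] both have at least [N] atoms, so [phi] cannot separate
    [z] from [y]. *)

Require Import Defs.
From HB Require Import structures.
From mathcomp Require Import all_boot all_order.
From mathcomp Require Import boolp classical_sets functions cardinality.
From mathcomp Require Import zify.

Set Implicit Arguments.
Unset Strict Implicit.
Unset Printing Implicit Defensive.

Import Order.Theory.

Local Open Scope classical_set_scope.
Local Open Scope card_scope.
Local Open Scope order_scope.

(** * Cardinalities truncated at a bound *)

Lemma injective_card_le (T U : Type) (A : set T) (C : set U) (f : T -> U) :
  {in A &, injective f} -> (forall a, A a -> C (f a)) -> A #<= C.
Proof.
move=> /Pinj[g fg] fC; rewrite -(card_le_eql (card_image g)) -fg.
by apply: subset_card_le => _ [a Aa <-]; apply: fC.
Qed.

(** Either [s] exhausts [S], or it has reached length [N]. Two such lists therefore have the same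
    length, although [S] may be infinite. *)
Definition count_witness (T : eqType) (N : nat) (S : set T) (s : seq T) :=
  [/\ uniq s, (size s <= N)%N, forall a, a \in s -> S a
    & (size s < N)%N -> forall a, S a -> a \in s].

Lemma count_witness_ex (T : eqType) (N : nat) (S : set T) :
  exists s, count_witness N S s.
Proof.
elim: N => [|N [s [us ss sS Ss]]]; first by exists [::]; split.
have [Ssub|] := pselect (forall a, S a -> a \in s).
  by exists s; split=> //; apply: leq_trans ss _.
move=> /existsNP[a /not_implyP[Sa /negP nsa]].
exists (a :: s); split=> /=; [by rewrite nsa|by [] | |].
  by move=> b; rewrite inE => /predU1P[->|/sS].
by rewrite ltnS => /Ss /(_ _ Sa); rewrite (negbTE nsa).
Qed.

(* [minn N #|S|], also when [S] is infinite. *)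
Definition tcount (T : eqType) (N : nat) (S : set T) : nat :=
  size (projT1 (cid (count_witness_ex N S))).

Section TruncatedCount.
Variable T : eqType.
Implicit Types (N M k : nat) (S A : set T) (s : seq T).

Lemma tcount_witness N S : exists2 s, count_witness N S s & tcount N S = size s.
Proof. by rewrite /tcount; case: cid => s ws; exists s. Qed.

Lemma count_witness_tcount N S s : count_witness N S s -> tcount N S = size s.
Proof.
have [t [ut st tS St] ->] := tcount_witness N S.
move=> [us ss sS Ss]; apply/eqP; rewrite eqn_leq; apply/andP; split.
  have [lts|ges] := ltnP (size s) N; last exact: leq_trans st ges.
  by apply: uniq_leq_size => // a /tS; apply: Ss.
have [lts|ges] := ltnP (size t) N; last exact: leq_trans ss ges.
by apply: uniq_leq_size => // a /sS; apply: St.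
Qed.

Lemma tcount_le N S : (tcount N S <= N)%N.
Proof. by have [s [_ ss _ _] ->] := tcount_witness N S. Qed.

Lemma count_witness_take M N S s : (M <= N)%N ->
  uniq s -> (forall a, a \in s -> S a) ->
  ((size s < N)%N -> forall a, S a -> a \in s) -> count_witness M S (take M s).
Proof.
move=> MN us sS Ss; split; first exact: take_uniq.
- by rewrite size_take_min geq_minl.
- by move=> a /mem_take/sS.
- rewrite size_take_min => lt a Sa.
  have ltM : (size s < M)%N by lia.
  by rewrite take_oversize ?(ltnW ltM)//; apply: Ss => //; lia.
Qed.

Lemma tcount_min M N S : (M <= N)%N -> tcount M S = minn M (tcount N S).
Proof.
move=> MN; have [s [us ss sS Ss] ->] := tcount_witness N S.
by rewrite (count_witness_tcount (count_witness_take MN us sS Ss)) size_take_min.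
Qed.

(** Concatenate witnesses of the two parts and cut at [N]. If the concatenation is shorter than [N],
    so is each piece, hence both pieces are exhaustive. *)
Lemma tcount_split N S A : tcount N S =
  minn N (tcount N [set a | S a /\ A a] + tcount N [set a | S a /\ ~ A a]).
Proof.
have [s [us ss sS Ss] ->] := tcount_witness N [set a | S a /\ A a].
have [t [ut st tS St] ->] := tcount_witness N [set a | S a /\ ~ A a].
have w : count_witness N S (take N (s ++ t)).
  apply: (count_witness_take (N := N)) => //.
  - rewrite cat_uniq us ut andbT /=; apply/hasPn => a at_.
    by apply/negP => /sS[_ Aa]; have [_] := tS _ at_.
  - by move=> a; rewrite mem_cat => /orP[/sS[]|/tS[]].
  - rewrite size_cat => lt a Sa; rewrite mem_cat; apply/orP.
    have [Aa|nAa] := pselect (A a); [left; apply: Ss|right; apply: St] => //; lia.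
by rewrite (count_witness_tcount w) size_take_min size_cat.
Qed.

Lemma tcount_subseq N k S : (k <= tcount N S)%N ->
  exists s, [/\ uniq s, size s = k & forall a, a \in s -> S a].
Proof.
have [s [us ss sS _] ->] := tcount_witness N S => ks.
exists (take k s); split; [exact: take_uniq|by rewrite size_take_min; lia|].
by move=> a /mem_take/sS.
Qed.

Lemma tcount_seq N s : uniq s -> tcount N [set a | a \in s] = minn N (size s).
Proof.
move=> us; rewrite -size_take_min; apply: count_witness_tcount.
exact: (count_witness_take (N := N)).
Qed.

(** A count below the truncation is exact: the witness lists all of [S], and the position in it is
    an injection. *)
Lemma tcount_lt N S : (tcount N S < N)%N -> S #<= `I_(tcount N S).
Proof.
have [s [us ss sS Ss] ->] := tcount_witness N S => /Ss Ssub.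
apply: (injective_card_le (f := index^~ s)) => [a b /[!inE] Sa Sb eq_ab|a Sa].
  by rewrite -(nth_index a (Ssub a Sa)) eq_ab nth_index ?Ssub.
by rewrite /= index_mem Ssub.
Qed.

Lemma tcount_card_le k S : (`I_k #<= S) <-> (k <= tcount k S)%N.
Proof.
split=> [kS|].
  rewrite leqNgt; apply/negP => lt.
  have := card_le_trans kS (tcount_lt lt).
  by rewrite card_le_II leqNgt lt.
move=> /tcount_subseq[s [us <- sS]].
(* [nth] needs a default element, so the empty list is treated apart. *)
case: s us sS => [|a0 s'] us sS.
  by rewrite (_ : `I_ _ = set0) ?card_ge0//; apply/seteqP; split.
set s := a0 :: s' in us sS *.
apply: (injective_card_le (f := nth a0 s)) => [i j|i i_s].
  by rewrite !inE => i_s j_s /eqP; rewrite nth_uniq// => /eqP.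
by apply: sS; rewrite mem_nth.
Qed.

(** The fibers over distinct values are disjoint, so [tcount_split] adds their counts one value at a
    time. *)
Lemma tcount_fibers (I : eqType) N S (g h : T -> I) (r : seq I) :
  (forall i, tcount N [set a | S a /\ g a = i] = tcount N [set a | S a /\ h a = i]) ->
  uniq r ->
  tcount N [set a | S a /\ g a \in r] = tcount N [set a | S a /\ h a \in r].
Proof.
move=> gh; elim: r => [_|i r IH /= /andP[ir ur]].
  by congr tcount; apply/seteqP; split=> a [].
have E (f : T -> I) : tcount N [set a | S a /\ f a \in i :: r] =
    minn N (tcount N [set a | S a /\ f a = i] +
            tcount N [set a | S a /\ f a \in r]).
  rewrite (tcount_split N [set a | S a /\ f a \in i :: r] [set a | f a = i]).
  congr (minn _ (_ + _)); congr tcount; apply/seteqP; split=> a /=.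
  - by move=> [[]].
  - by move=> [Sa ->]; rewrite mem_head.
  - by move=> [[Sa]]; rewrite inE => /predU1P[].
  - move=> [Sa fr]; rewrite inE fr orbT; split=> // fi.
    by rewrite -fi fr in ir.
by rewrite !E gh IH.
Qed.

End TruncatedCount.

(** * Atoms and types of atoms over an environment *)

Section Atoms.
Context {d : Order.disp_t} {B : ctbDistrLatticeType d}.
Implicit Types (a b x y : B).

(** The meet of [a] with [x] is [\bot] or [a]. This makes membership below an atomic Boolean
    combination a matter of truth tables. *)
Lemma atom_leC x a : is_atom a -> (a <= ~` x) = ~~ (a <= x).
Proof.
move=> [a0 ha]; rewrite -disj_leC.
rewrite leEmeet; have [->|->] := ha _ (leIl a x).
  by rewrite eqxx eq_sym a0.
by rewrite (negbTE a0) eqxx.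
Qed.

Lemma atom_leU x y a : is_atom a -> (a <= x `|` y) = (a <= x) || (a <= y).
Proof.
move=> at_a; rewrite -[x `|` y]complK complU atom_leC// lexI !atom_leC//.
by rewrite negb_and !negbK.
Qed.

Lemma atom_le0 a : is_atom a -> (a <= \bot) = false.
Proof. by move=> [a0 _]; rewrite lex0 (negbTE a0). Qed.

Lemma atom_le_joins (I : Type) (r : seq I) (F : I -> B) a : is_atom a ->
  (a <= \join_(i <- r) F i) = has (fun i => a <= F i) r.
Proof.
move=> at_a; elim: r => [|i r IH] /=; first by rewrite big_nil atom_le0.
by rewrite big_cons atom_leU// IH.
Qed.

Lemma le_meets (I : Type) (r : seq I) (F : I -> B) x :
  (x <= \meet_(i <- r) F i) = all (fun i => x <= F i) r.
Proof.
elim: r => [|i r IH] /=; first by rewrite big_nil lex1.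
by rewrite big_cons lexI IH.
Qed.

Lemma atom_le_atom a b : is_atom a -> is_atom b -> (a <= b) = (a == b).
Proof.
move=> [a0 _] [_ hb]; apply/idP/eqP => [/hb[/eqP|//]|->//].
by rewrite (negbTE a0).
Qed.

Lemma atom_le_join_atoms (s : seq B) a : (forall b, b \in s -> is_atom b) ->
  is_atom a -> (a <= \join_(b <- s) b) = (a \in s).
Proof.
move=> at_s at_a; rewrite atom_le_joins//; apply/hasP/idP => [[b bs]|as_].
  by rewrite (atom_le_atom at_a (at_s b bs)) => /eqP->.
by exists a.
Qed.

Lemma atomic_le x y : atomic B ->
  (forall a, is_atom a -> a <= x -> a <= y) -> x <= y.
Proof.
move=> atB xy; rewrite -[y]complK -disj_leC; apply/eqP.
apply: contrapT => /eqP/atB[a at_a]; rewrite lexI => /andP[/xy-/(_ at_a) ay].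
by rewrite atom_leC// ay.
Qed.

Lemma atomic_eq x y : atomic B ->
  (forall a, is_atom a -> (a <= x) = (a <= y)) -> x = y.
Proof.
by move=> atB xy; apply/eqP; rewrite eq_le !atomic_le// => a at_a; rewrite xy.
Qed.

Definition atype n (e : 'I_n -> B) a : {ffun 'I_n -> bool} :=
  [ffun i => a <= e i].

(** The minterm of the type [p], evaluated at [e]. *)
Definition cell n (e : 'I_n -> B) (p : {ffun 'I_n -> bool}) : B :=
  \meet_(i <- enum 'I_n) (if p i then e i else ~` e i).

Lemma atom_le_cell n (e : 'I_n -> B) p a : is_atom a ->
  (a <= cell e p) = (atype e a == p).
Proof.
move=> at_a; rewrite /cell le_meets; apply/allP/eqP => [H|<- i _].
  apply/ffunP => i; have := H i (mem_enum _ i); rewrite ffunE.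
  by case: (p i) => //; rewrite atom_leC// => /negbTE.
by rewrite ffunE; case: ifPn => //; rewrite atom_leC.
Qed.

(** Evaluation in the two-element algebra, to which every atom [a] gives the homomorphism sending
    [x] to [a <= x]. *)
Fixpoint teval n (p : {ffun 'I_n -> bool}) (t : term n) : bool :=
  match t with
  | Var i => p i
  | Zero => false
  | One => true
  | Cap t1 t2 => teval p t1 && teval p t2
  | Cup t1 t2 => teval p t1 || teval p t2
  | Neg t1 => ~~ teval p t1
  end.

Lemma atom_le_eval n (e : 'I_n -> B) (t : term n) a : is_atom a ->
  (a <= eval e t) = teval (atype e a) t.
Proof.
move=> at_a; elim: t => //= [i|||t1 <- t2 <-|t1 <- t2 <-|t <-].
- by rewrite ffunE.
- exact: atom_le0.
- exact: lex1.
- exact: lexI.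
- exact: atom_leU.
- exact: atom_leC.
Qed.

(** * Similar environments and the answers to moves *)

Definition similar N n (e f : 'I_n -> B) : Prop := forall p,
  tcount N [set a | is_atom a /\ atype e a = p] =
  tcount N [set a | is_atom a /\ atype f a = p].

Lemma similar_sym N n (e f : 'I_n -> B) : similar N e f -> similar N f e.
Proof. by move=> ef p; rewrite ef. Qed.

Lemma similar_le M N n (e f : 'I_n -> B) : (M <= N)%N ->
  similar N e f -> similar M e f.
Proof. by move=> MN ef p; rewrite !(tcount_min _ MN) ef. Qed.

(** The atoms below the value of [t] form the union of the classes of those types that make [t]
    true, so [tcount_fibers] applies. *)
Lemma similar_eval N n (e f : 'I_n -> B) (t : term n) : similar N e f ->
  tcount N (atoms_below (eval e t)) = tcount N (atoms_below (eval f t)).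
Proof.
move=> ef.
have E g : atoms_below (eval g t) =
    [set a | is_atom a /\
      atype g a \in [seq p <- enum {: {ffun 'I_n -> bool}} | teval p t]].
  by apply/seteqP; split=> a [at_a] /=;
    rewrite mem_filter mem_enum andbT -atom_le_eval.
by rewrite !E; apply: tcount_fibers => //; rewrite filter_uniq// enum_uniq.
Qed.

Lemma tcount_atoms0 x : atomic B -> tcount 1 (atoms_below x) = 0 <-> x = \bot.
Proof.
move=> atB; have [s [us ss sS Ss] ->] := tcount_witness 1 (atoms_below x).
split=> [s0|x0].
  apply: atomic_eq => // a at_a; rewrite atom_le0//; apply/negP => ax.
  by have := Ss _ a (conj at_a ax); rewrite s0 (size0nil s0) => /(_ isT).
case: s us ss sS Ss => // b s _ _ /(_ b (mem_head _ _))[at_b].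
by rewrite x0 atom_le0.
Qed.

(** The symmetric difference turns an equation into the absence of atoms below one term, which a
    count truncated at 1 detects. *)
Lemma eval_eq n (e : 'I_n -> B) (t1 t2 : term n) : atomic B ->
  eval e t1 = eval e t2 <->
  eval e (Cup (Cap t1 (Neg t2)) (Cap t2 (Neg t1))) = \bot.
Proof.
move=> atB; split=> /= [->|H]; first by rewrite meetxC joinxx.
apply: atomic_eq => // a at_a; have := atom_le0 at_a.
rewrite -H atom_leU// !lexI !atom_leC//.
by case: (a <= _); case: (a <= _).
Qed.

(* If one of the two parts is small, copy its exact size; otherwise cut off
   [M] atoms. *)
Lemma split_similar M (S S' : set B) x :
  S `<=` is_atom (B := B) -> S' `<=` is_atom (B := B) ->
  tcount (2 * M) S = tcount (2 * M) S' ->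
  exists y, tcount M [set a | S a /\ a <= x] = tcount M [set a | S' a /\ a <= y]
    /\ tcount M [set a | S a /\ ~ a <= x] = tcount M [set a | S' a /\ ~ a <= y].
Proof.
move=> Sat S'at SS'.
have M2 : (M <= 2 * M)%N by lia.
have cut k : (k <= tcount (2 * M) S')%N -> exists y,
    tcount (2 * M) [set a | S' a /\ a <= y] = minn (2 * M) k.
  move=> /tcount_subseq[s [us <- sS]]; exists (\join_(b <- s) b).
  rewrite -tcount_seq//; congr tcount; apply/seteqP; split=> a /=.
    by move=> [S'a]; rewrite atom_le_join_atoms//; [move=> b /sS|]; apply: S'at.
  move=> as_; split; first exact: sS.
  by rewrite atom_le_join_atoms//; [move=> b /sS|have := sS _ as_]; apply: S'at.
have split_S := tcount_split (2 * M) S [set a | a <= x].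
have split_S' y := tcount_split (2 * M) S' [set a | a <= y].
have flip y : tcount (2 * M) [set a | S' a /\ a <= ~` y] =
    tcount (2 * M) [set a | S' a /\ ~ a <= y].
  congr tcount; apply/seteqP; split=> a /= [S'a];
  by rewrite atom_leC; [split=> //; apply/negP|apply: S'at].
have flip' y : tcount (2 * M) [set a | S' a /\ ~ a <= ~` y] =
    tcount (2 * M) [set a | S' a /\ a <= y].
  by rewrite -flip complK.
pose u := tcount (2 * M) [set a | S a /\ a <= x].
pose v := tcount (2 * M) [set a | S a /\ ~ a <= x].
have := tcount_le (2 * M) [set a | S a /\ a <= x].
have := tcount_le (2 * M) [set a | S a /\ ~ a <= x].
have leS' y := tcount_le (2 * M) [set a | S' a /\ ~ a <= y].
move: split_S; rewrite /= -/u -/v SS' => split_S vM uM.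
(* If [u < M], remove exactly [u] atoms: the rests then agree up to [2 * M - u], which exceeds [M].
   If [v < M], the same is done on the other side, whence the complement. *)
have [uM'|uM'] := ltnP u M; last have [vM'|vM'] := ltnP v M.
- have [|y ey] := cut u; first by lia.
  exists y; rewrite !(tcount_min _ M2) -/u -/v ey.
  by have := split_S' y; have := leS' y; rewrite /= ey; lia.
- have [|y ey] := cut v; first by lia.
  exists (~` y); rewrite !(tcount_min _ M2) flip flip' -/u -/v ey.
  by have := split_S' y; have := leS' y; rewrite /= ey; lia.
(* Both parts have at least [M] atoms, so [S'] has at least [2 * M], and cutting off [M] leaves at
   least [M]. This is the reason for the factor 2. *)
- have [|y ey] := cut M; first by lia.
  exists y; rewrite !(tcount_min _ M2) -/u -/v ey.
  by have := split_S' y; have := leS' y; rewrite /= ey; lia.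
Qed.

(** A new element splits each class in two. The class of each type [p] is answered separately by
    some [F p], and the answers are glued along the cells of [f], which share no atoms. *)
Lemma extend_similar M n (e f : 'I_n -> B) x : similar (2 * M) e f ->
  exists y, similar M (extend_env x e) (extend_env y f).
Proof.
move=> ef.
have /choice[F hF] p := @split_similar M _ _ x
  (fun a (H : is_atom a /\ atype e a = p) => proj1 H)
  (fun a (H : is_atom a /\ atype f a = p) => proj1 H) (ef p).
pose y := \join_(p <- enum {: {ffun 'I_n -> bool}}) (cell f p `&` F p).
have ley a : is_atom a -> (a <= y) = (a <= F (atype f a)).
  move=> at_a; rewrite atom_le_joins//; apply/hasP/idP => [[p _]|aF].
    by rewrite lexI atom_le_cell// => /andP[/eqP->].
  by exists (atype f a); rewrite ?mem_enum// lexI atom_le_cell// eqxx.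
have ext z (g : 'I_n -> B) a (p : {ffun 'I_n.+1 -> bool}) :
    atype (extend_env z g) a = p <->
    (a <= z) = p ord0 /\ atype g a = [ffun i => p (lift ord0 i)].
  split=> [<-|[zp gp]].
    rewrite ffunE /extend_env unlift_none; split=> //.
    by apply/ffunP => i; rewrite !ffunE liftK.
  apply/ffunP => i; rewrite ffunE /extend_env; case: unliftP => [j ->|-> //].
  by move/ffunP/(_ j): gp; rewrite !ffunE.
exists y => p; set q : {ffun 'I_n -> bool} := [ffun i => p (lift ord0 i)].
have [h1 h2] := hF q.
have E z (g : 'I_n -> B) (b : bool) : p ord0 = b ->
    [set a | is_atom a /\ atype (extend_env z g) a = p] =
    [set a | (is_atom a /\ atype g a = q) /\ (a <= z) = b].
  move=> pb; apply/seteqP; split=> a /=.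
    by move=> [at_a /ext[]]; rewrite pb.
  by move=> [[at_a gq] zb]; split=> //; apply/ext; rewrite pb.
case p0: (p ord0); rewrite !(E _ _ _ p0).
  rewrite h1; congr tcount; apply/seteqP; split=> a /= [[at_a fq]];
  by rewrite ley// fq.
have NE z (g : 'I_n -> B) :
    [set a | (is_atom a /\ atype g a = q) /\ (a <= z) = false] =
    [set a | (is_atom a /\ atype g a = q) /\ ~ a <= z].
  apply/seteqP; split=> a /= [? az]; split=> //; first by rewrite az.
  exact/negbTE/negP.
rewrite !NE h2; congr tcount; apply/seteqP; split=> a /= [[at_a fq]];
by rewrite ley// fq.
Qed.

(** The truncation that [phi] requires: 1 decides whether a symmetric difference vanishes, [k]
    decides [C_k], and each quantifier costs the doubling of [extend_similar]. *)
Fixpoint rank n (phi : formula n) : nat :=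
  match phi with
  | Eq _ _ _ => 1
  | Card _ k _ _ => k
  | Not _ f => rank f
  | And _ f g | Or _ f g | Imp _ f g => maxn (rank f) (rank g)
  | All _ f | Ex _ f => 2 * rank f
  end.

Lemma sat_similar n (phi : formula n) (e f : 'I_n -> B) : atomic B ->
  similar (rank phi) e f -> sat phi e <-> sat phi f.
Proof.
move=> atB; elim: n / phi e f => /=.
- move=> n t1 t2 e f ef.
  by rewrite !eval_eq// -!tcount_atoms0// (similar_eval _ ef).
- by move=> n k _ t e f ef; rewrite !tcount_card_le (similar_eval _ ef).
- by move=> n g IH e f /IH ->.
- move=> n g IHg h IHh e f ef.
  by rewrite (IHg e f) ?(IHh e f)//; apply: similar_le ef;
    rewrite ?leq_maxl ?leq_maxr.
- move=> n g IHg h IHh e f ef.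
  by rewrite (IHg e f) ?(IHh e f)//; apply: similar_le ef;
    rewrite ?leq_maxl ?leq_maxr.
- move=> n g IHg h IHh e f ef.
  by rewrite (IHg e f) ?(IHh e f)//; apply: similar_le ef;
    rewrite ?leq_maxl ?leq_maxr.
- move=> n g IH.
  suff half e f : similar (2 * rank g) e f ->
      (forall b : B, sat g (extend_env b e)) ->
      forall b : B, sat g (extend_env b f).
    by move=> e f ef; split; apply: half => //; apply: similar_sym.
  (* The move [b] is made next to [f] and answered next to [e], where the hypothesis [He] covers
     every element. *)
  move=> /similar_sym ef He b; have [c bc] := extend_similar b ef.
  exact/(IH _ _ bc).
- move=> n g IH.
  suff half e f : similar (2 * rank g) e f ->
      (exists b : B, sat g (extend_env b e)) ->
      exists b : B, sat g (extend_env b f).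
    by move=> e f ef; split; apply: half => //; apply: similar_sym.
  move=> ef [b Hb]; have [c bc] := extend_similar b ef.
  by exists c; apply/(IH _ _ bc).
Qed.

(** With one variable there are only two types: below the element and below its complement. *)
Lemma similar1 N x y :
  tcount N (atoms_below x) = tcount N (atoms_below y) ->
  tcount N (atoms_below (~` x)) = tcount N (atoms_below (~` y)) ->
  similar N (fun _ : 'I_1 => x) (fun _ : 'I_1 => y).
Proof.
move=> xy xyC p.
have E z : [set a | is_atom a /\ atype (fun _ : 'I_1 => z) a = p] =
    atoms_below (if p ord0 then z else ~` z).
  have aE a : (atype (fun _ : 'I_1 => z) a = p) <-> (a <= z) = p ord0.
    split=> [<-|zp]; first by rewrite ffunE.
    by apply/ffunP => i; rewrite ffunE ord1.
  apply/seteqP; split=> a [at_a /=].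
    by rewrite aE => <-; split=> //; case: ifPn => //; rewrite atom_leC.
  move=> az; split=> //; apply/aE; move: az.
  by case: (p ord0) => //; rewrite atom_leC// => /negbTE.
by rewrite !E; case: (p ord0).
Qed.

End Atoms.

(** * Undefinability of the ideal *)

Theorem theorem4 (d : Order.disp_t) (B : ctbDistrLatticeType d)
    (infinite_B : infinite_set [set: B]) (atomic_B : atomic B) :
  ~ exists phi : formula 1, exists2 Fin : set B, Fin = interp B phi &
    [/\ proper_ideal Fin,
        forall (n : nat) (x : B), atoms_below x #<= `I_n -> Fin x
      & forall x : B, ~ Fin x ->
          exists y : B, [/\ y < x, ~ Fin y & ~ Fin (x `&` ~` y)]].
Proof.
move=> [phi [Fin def_Fin [[_ _ down Fin_proper] small split_Fin]]].
have nFin1 : ~ Fin \top.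
  move=> F1; apply: Fin_proper; apply/seteqP; split=> // x _.
  exact: down F1 (lex1 x).
have [y [_ nFy]] := split_Fin _ nFin1; rewrite meet1x => nFCy.
pose N := rank phi.
(* With fewer than [N] atoms below it, [x] would lie in [Fin] by [small]. *)
have large x : ~ Fin x -> tcount N (atoms_below x) = N.
  move=> nFx; apply/eqP; rewrite eqn_leq tcount_le /= leqNgt.
  by apply/negP => /tcount_lt/small.
have [|s [us sN sy]] := @tcount_subseq _ N N (atoms_below y).
  by rewrite large.
pose z := \join_(b <- s) b.
have at_s b : b \in s -> is_atom b by move=> /sy[].
have zs : atoms_below z = [set a | a \in s].
  apply/seteqP; split=> a /=; first by move=> [at_a]; rewrite atom_le_join_atoms.
  by move=> as_; split; [exact: at_s|rewrite atom_le_join_atoms//; exact: at_s].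
have tz : tcount N (atoms_below z) = N by rewrite zs tcount_seq// sN minnn.
have Fz : Fin z.
  (* [z] has exactly [N] atoms; truncating at [N.+1] instead keeps the count strictly below the
     bound, hence exact. *)
  apply: (small N.+1).
  have lt : (tcount N.+1 (atoms_below z) < N.+1)%N.
    by rewrite zs tcount_seq// sN; lia.
  by apply: card_le_trans (tcount_lt lt) _; rewrite card_le_II tcount_le.
(* Since [z] lies below [y], its complement lies above that of [y], which is outside the ideal. Then
   [large] applies to it as well. *)
have nFCz : ~ Fin (~` z).
  move=> FCz; apply: nFCy; apply: down FCz _; rewrite leC.
  apply: atomic_le => // a at_a.
  by rewrite atom_le_join_atoms// => /sy[].
have yz : similar N (fun _ : 'I_1 => y) (fun _ : 'I_1 => z).
  by apply: similar1; rewrite ?tz !large.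
by apply: nFy; move: Fz; rewrite def_Fin => /(sat_similar atomic_B yz).
Qed.
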